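(* For every integer $r\ge 3$, $$t(r+1,r)\le s(r+1,r)+2\,r!\,\sqrt{r(r+1)\bigl(1-s(r+1,r)\bigr)\Bigl(s(r+1,r)-\frac1r\Bigr)}.$$
   Context: Let $r<k$ be positive integers and $X$ a set. A sequence $x\in X^r$ covers a sequence $a\in X^k$ if $x$ is a (not necessarily contiguous) subsequence of $a$, i.e., $x$ is obtained from $a$ by removing $k-r$ entries while keeping the order of the remaining entries. A set $C\subseteq X^r$ covering $X^k$ (i.e., such that every sequence in $X^k$ is covered by at least one sequence in $C$) is called a covering $(k-r)$-insertion code over $X$. Write $[n]=\{0,1,\ldots,n-1\}$. $S(n,k,r)$ denotes the minimum cardinality of a covering $(k-r)$-insertion code $C\subseteq[n]^r$ over $[n]$, and $s(k,r)=\lim_{n\to\infty}S(n,k,r)/n^r$ (this limit exists). For $1<r<k<n$, a family $C$ of $r$-element subsets of $[n]$ is a Turán $(n,k,r)$-system if every $k$-element subset of $[n]$ contains at least one member of $C$. $T(n,k,r)$ denotes the minimum cardinality of a Turán $(n,k,r)$-system, and $t(k,r)=\lim_{n\to\infty}T(n,k,r)/\binom nr$ is the Turán density (the limit exists because the sequence is non-decreasing in $n$). *)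

(* Defs.v *)
From HB Require Import structures.
From mathcomp Require Import all_boot all_order all_algebra.
From mathcomp Require Import all_classical all_reals all_analysis.
Set Implicit Arguments.
Unset Strict Implicit.
Unset Printing Implicit Defensive.
Import Order.TTheory GRing.Theory Num.Theory.
Import numFieldNormedType.Exports.
Local Open Scope ring_scope.

Definition covers (X : eqType) (r k : nat) (x : r.-tuple X) (a : k.-tuple X) :
  bool := subseq x a.

Definition covering_insertion_code (X : finType) (k r : nat)
    (C : {set r.-tuple X}) : bool :=
  [forall a : k.-tuple X, exists x in C, covers x a].

(* The default [set: _] of the minimization is itself a covering code when
   r <= k, so this is the true minimum over all covering codes. *)
Definition insertion_number (n k r : nat) : nat :=
  #|[arg min_(C < [set: r.-tuple 'I_n] | covering_insertion_code k C) #|C| ]|.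

Definition insertion_density (R : realType) (k r : nat) : R :=
  limn (fun n : nat => (insertion_number n k r)%:R / n%:R ^+ r : R).

Definition turan_system (n k r : nat) (C : {set {set 'I_n}}) : bool :=
  [forall A in C, #|A| == r] &&
  [forall K : {set 'I_n}, (#|K| == k) ==> [exists A in C, A \subset K]].

(* The default, the family of all r-subsets, is itself a Turan system when
   r <= k, so this is the true minimum over all Turan systems. *)
Definition turan_number (n k r : nat) : nat :=
  #|[arg min_(C < [set A : {set 'I_n} | #|A| == r] | turan_system k r C) #|C| ]|.

Definition turan_density (R : realType) (k r : nat) : R :=
  limn (fun n : nat => (turan_number n k r)%:R / 'C(n, r)%:R : R).

(* Main.v *)
Require Import Defs.
From HB Require Import structures.
From mathcomp Require Import all_boot all_order all_algebra.
From mathcomp Require Import fingroup perm.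
From mathcomp Require Import all_classical all_reals all_analysis.
Set Implicit Arguments.
Unset Strict Implicit.
Unset Printing Implicit Defensive.
Import Order.TTheory GRing.Theory Num.Theory.
Import numFieldNormedType.Exports.
Local Open Scope ring_scope.

(** The sharper inequality t(k, r) <= s(k, r) holds for all r <= k; the theorem
follows because the square-root term is nonnegative.

Let C be a covering (k - r)-insertion code over [n] and let p be a permutation
of [n].  List each set A increasingly and apply p to the list; the r-sets A
whose image word lies in C form a Turan (n, k, r)-system.  Indeed, the word
obtained from a k-set K has a subword in C, and this subword comes from an
r-subset of K.  For a uniformly random p, each injective word of length r is
the image word of a given r-set with probability (n - r)!/n!, so the expected
size of the system is at most |C|/r!.  Hence T(n, k, r) r! <= S(n, k, r)
([turan_number_insertion_number]).

Dividing by n^r and letting n tend to infinity gives the inequality between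
the densities, once both limits are known to exist.  The ratio T(n, k, r)/C(n, r)
is nondecreasing, by averaging over the deletion of one vertex
([turan_number_succ]), and is bounded by 1.  For codes, pulling a code over [n]
back along y |-> y mod n yields S(N, k, r) <= S(n, k, r) (floor(N/n) + 1)^r
([insertion_number_blowup]), so that S(n, k, r)/n^r converges to its infimum
over n > 0 ([is_cvg_of_dilation]). *)

(** * Minimum codes and minimum Turan systems *)

Lemma covering_insertion_code_setT (X : finType) (k r : nat) :
  (r <= k)%N -> covering_insertion_code k [set: r.-tuple X].
Proof.
move=> lerk; apply/forallP => a; apply/existsP.
have sz : size (take r a) == r by rewrite size_takel // size_tuple.
by exists (Tuple sz); rewrite inE /covers /= take_subseq.
Qed.

Lemma insertion_number_le (n k r : nat) (C : {set r.-tuple 'I_n}) :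
  (r <= k)%N -> covering_insertion_code k C ->
  (insertion_number n k r <= #|C|)%N.
Proof.
move=> lerk covC; rewrite /insertion_number.
case: arg_minnP => [|D _ minD]; first exact: covering_insertion_code_setT.
exact: minD.
Qed.

Lemma insertion_number_attained (n k r : nat) :
  (r <= k)%N ->
  exists2 C : {set r.-tuple 'I_n},
    covering_insertion_code k C & #|C| = insertion_number n k r.
Proof.
move=> lerk; rewrite /insertion_number.
case: arg_minnP => [|D covD _]; first exact: covering_insertion_code_setT.
by exists D.
Qed.

Lemma turan_system_all (n k r : nat) :
  (r <= k)%N -> turan_system k r [set A : {set 'I_n} | #|A| == r].
Proof.
move=> lerk; apply/andP; split.
  by apply/forallP => A; apply/implyP; rewrite inE.
apply/forallP => K; apply/implyP => /eqP cardK.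
move: lerk; rewrite -cardK => /card_geqP [s [uniq_s size_s sK]].
apply/existsP; exists [set x in s]; apply/andP; split.
  by rewrite inE cardsE -size_s; apply/eqP/card_uniqP.
by apply/fintype.subsetP => x; rewrite inE => /sK.
Qed.

Lemma turan_number_le (n k r : nat) (C : {set {set 'I_n}}) :
  (r <= k)%N -> turan_system k r C -> (turan_number n k r <= #|C|)%N.
Proof.
move=> lerk turC; rewrite /turan_number.
case: arg_minnP => [|D _ minD]; first exact: turan_system_all.
exact: minD.
Qed.

Lemma turan_number_attained (n k r : nat) :
  (r <= k)%N ->
  exists2 C : {set {set 'I_n}},
    turan_system k r C & #|C| = turan_number n k r.
Proof.
move=> lerk; rewrite /turan_number.
case: arg_minnP => [|D turD _]; first exact: turan_system_all.
by exists D.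
Qed.

Lemma turan_number_le_bin (n k r : nat) :
  (r <= k)%N -> (turan_number n k r <= 'C(n, r))%N.
Proof.
move=> lerk; apply: leq_trans (turan_number_le lerk (turan_system_all _ lerk)) _.
by rewrite card_draws card_ord.
Qed.

(** * From covering codes to Turan systems *)

(** Two permutations with the same prescribed values on [l] differ by a
permutation supported outside [l]. *)
Lemma card_perm_prescribed_le (T : finType) (l y : seq T) :
  uniq l ->
  (#|[set s : {perm T} | map s l == y]| <= (#|T| - size l)`!)%N.
Proof.
move=> uniq_l; set P := [set s : {perm T} | _].
have [->|[s0]] := set_0Vmem P; first by rewrite cards0.
rewrite inE => /eqP s0P.
have -> : (#|T| - size l)%N = #|~: [set z in l]|.
  by rewrite cardsCs finset.setCK cardsE (card_uniqP uniq_l).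
rewrite -card_perm -(card_imset (mem P) (mulIg s0^-1)%g).
apply: subset_leq_card; apply/fintype.subsetP => _ /imsetP [s sP ->].
apply/fintype.subsetP => z; rewrite !inE; apply: contra => zl.
have /eq_in_map/(_ z zl) sz : map s l = map s0 l.
  by move: sP; rewrite inE s0P => /eqP.
by rewrite permM sz permK.
Qed.

(** The r-subsets of [n] whose increasing enumeration is mapped letterwise by
[s] to a word of [C]. *)
Definition relabelled_system (n r : nat) (C : {set r.-tuple 'I_n})
    (s : {perm 'I_n}) : {set {set 'I_n}} :=
  [set A : {set 'I_n} |
    (#|A| == r) && [exists x in C, map s (enum A) == x]].

(** The canonical enumeration is compatible with passing to a subset: this is
what makes a subword of the word of [K] the word of a subset of [K]. *)
Lemma enum_subseq (T : finType) (K : {set T}) (b : seq T) :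
  subseq b (enum K) -> enum [set y in b] = b.
Proof.
move=> sub_b.
have sub_T : subseq b (enum T).
  by apply: subseq_trans sub_b _; rewrite enumT; apply: filter_subseq.
have bE : b = [seq y <- enum T | y \in b] by exact/(subseq_uniqP (enum_uniq T)).
rewrite [RHS]bE enumT; apply: eq_filter => y.
by rewrite -[LHS]/(y \in [set z in b]) inE.
Qed.

Lemma relabelled_system_turan (n k r : nat) (C : {set r.-tuple 'I_n})
    (s : {perm 'I_n}) :
  covering_insertion_code k C -> turan_system k r (relabelled_system C s).
Proof.
move=> /forallP covC; apply/andP; split.
  by apply/forallP => A; apply/implyP; rewrite inE => /andP [].
apply/forallP => K; apply/implyP => cardK.
have size_a : size (map s (enum K)) == k by rewrite size_map -cardE.
have /existsP [x /andP [xC /subseqP [m _ /= x_eq]]] := covC (Tuple size_a).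
set b := mask m (enum K).
have enum_b : enum [set y in b] = b by apply: enum_subseq; exact: mask_subseq.
have map_b : map s b = x by rewrite x_eq map_mask.
apply/existsP; exists [set y in b]; apply/andP; split.
  rewrite inE; apply/andP; split.
    by rewrite cardE enum_b -(size_map s) map_b size_tuple.
  by apply/existsP; exists x; rewrite xC enum_b map_b /=.
apply/fintype.subsetP => y; rewrite inE => /(mem_subseq (mask_subseq m _)).
by rewrite mem_enum.
Qed.

(** Double counting of the triples ([s], [A], [x]) with [x] in [C] and
[map s (enum A) = x]. *)
Lemma sum_card_relabelled_system_le (n r : nat) (C : {set r.-tuple 'I_n}) :
  (\sum_(s : {perm 'I_n}) #|relabelled_system C s|
     <= 'C(n, r) * #|C| * (n - r)`!)%N.
Proof.
have le1 (s : {perm 'I_n}) : (#|relabelled_system C s| <=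
    \sum_(A : {set 'I_n} | #|A| == r) \sum_(x in C) (map s (enum A) == x))%N.
  rewrite -sum1_card (eq_bigl (fun A : {set 'I_n} => (#|A| == r) &&
    [exists x in C, map s (enum A) == x])); last by move=> A; rewrite inE.
  rewrite big_mkcondr leq_sum // => A _; case: existsP => // -[x /andP [xC sx]].
  by rewrite (bigD1 x) //= sx.
apply: (leq_trans (leq_sum _ (fun s _ => le1 s))).
rewrite exchange_big /=.
have -> : 'C(n, r) = #|[set A : {set 'I_n} | #|A| == r]|.
  by rewrite card_draws card_ord.
rewrite -mulnA -sum_nat_const big_set /=; apply: leq_sum => A /eqP cardA.
rewrite exchange_big /= -sum_nat_const; apply: leq_sum => x _.
have := card_perm_prescribed_le (val x) (enum_uniq A).
rewrite -cardE cardA card_ord; apply: leq_trans.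
by rewrite -big_mkcond /= sum1_card cardsE.
Qed.

(** Some permutation does at least as well as the average one. *)
Lemma turan_number_insertion_number (n k r : nat) :
  (r <= k)%N -> (turan_number n k r * r`! <= insertion_number n k r)%N.
Proof.
move=> lerk; have [C covC <-] := insertion_number_attained n lerk.
have [lern|ltnr] := leqP r n; last first.
  have := turan_number_le_bin n lerk; rewrite bin_small // leqn0 => /eqP ->.
  by rewrite mul0n.
have binM : (0 < 'C(n, r) * (n - r)`!)%N by rewrite muln_gt0 bin_gt0 lern fact_gt0.
(* Multiplying by C(n, r) (n - r)! turns the factor r! into n!, the number of
   permutations. *)
rewrite -(leq_pmul2r binM).
have -> : (turan_number n k r * r`! * ('C(n, r) * (n - r)`!) =
           n`! * turan_number n k r)%N.
  by rewrite -(bin_fact lern) -mulnA (mulnCA r`!) mulnC.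
rewrite mulnCA mulnA -card_Sn -cardsT -sum_nat_const big_mkcond /=.
apply: leq_trans (sum_card_relabelled_system_le C).
apply: leq_sum => s _; rewrite finset.in_setT; apply: turan_number_le => //.
exact: relabelled_system_turan.
Qed.

(** * Recursive inequalities for both minima *)

(** The members of [C] that avoid the vertex [i], transported to [n] by the
increasing bijection [lift i] from [n] onto [n + 1] minus [i]. *)
Definition vertex_deletion (n : nat) (C : {set {set 'I_n.+1}}) (i : 'I_n.+1) :
    {set {set 'I_n}} :=
  [set A : {set 'I_n} | lift i @: A \in C].

Lemma vertex_deletion_turan (n k r : nat) (C : {set {set 'I_n.+1}}) i :
  turan_system k r C -> turan_system k r (vertex_deletion C i).
Proof.
move=> /andP [/forallP cardC /forallP turC]; apply/andP; split.
  apply/forallP => A; apply/implyP; rewrite inE => AC.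
  by have := implyP (cardC _) AC; rewrite card_imset //; exact: lift_inj.
apply/forallP => K; apply/implyP => cardK.
have : #|lift i @: K| == k by rewrite card_imset //; exact: lift_inj.
move=> /(implyP (turC _)) /existsP [B /andP [BC /fintype.subsetP BK]].
have liftB : lift i @: (lift i @^-1: B) = B.
  apply/setP => z; apply/imsetP/idP => [[y yB ->]|zB].
    by move: yB; rewrite inE.
  by have /imsetP [y yK zy] := BK z zB; exists y; rewrite // inE -zy.
apply/existsP; exists (lift i @^-1: B); rewrite inE liftB BC /=.
apply/fintype.subsetP => y; rewrite inE => /BK /imsetP [y' y'K /lift_inj ->] //.
Qed.

(** Each r-set in a system on [n + 1] survives the deletion of exactly
[n + 1 - r] vertices. *)
Lemma turan_number_succ (n k r : nat) :
  (r <= k)%N ->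
  (n.+1 * turan_number n k r <= turan_number n.+1 k r * (n.+1 - r))%N.
Proof.
move=> lerk; have [C turC <-] := turan_number_attained n.+1 lerk.
have le1 (i : 'I_n.+1) : (turan_number n k r <= \sum_(B in C) (i \notin B))%N.
  apply: leq_trans (turan_number_le lerk (vertex_deletion_turan i turC)) _.
  rewrite -(card_imset _ (imset_inj (@lift_inj _ i))) -big_mkcondr sum1_card.
  apply: subset_leq_card; apply/fintype.subsetP => _ /imsetP [A AC ->].
  rewrite inE in AC; apply/andP; split=> //.
  by apply/imsetP => -[y _ /eqP]; rewrite (negbTE (neq_lift i y)).
apply: (@leq_trans (\sum_(i < n.+1) \sum_(B in C) (i \notin B))%N).
  rewrite -[X in (X * _ <= _)%N]card_ord -sum_nat_const.
  by apply: leq_sum => i _; apply: le1.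
rewrite exchange_big /= -sum_nat_const; apply: leq_sum => B BC.
case/andP: turC => /forallP /(_ B) /implyP /(_ BC) /eqP cardB _.
rewrite -big_mkcond /= sum1_card.
have -> : (n.+1 - r)%N = #|~: B| by rewrite cardsCs finset.setCK cardB card_ord.
by rewrite subset_leq_card //; apply/fintype.subsetP => i iB; rewrite finset.in_setC.
Qed.

Lemma insertion_number_blowup (N n k r : nat) :
  (0 < n)%N -> (r <= k)%N ->
  (insertion_number N k r <= insertion_number n k r * (N %/ n).+1 ^ r)%N.
Proof.
move=> n_gt0 lerk; have [C covC <-] := insertion_number_attained n lerk.
(* A word of D is determined by its letterwise residues, which form a word of
   C, and its letterwise quotients, which are arbitrary. *)
pose f (y : 'I_N) : 'I_n := Ordinal (ltn_pmod y n_gt0).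
have ltq (y : 'I_N) : (y %/ n < (N %/ n).+1)%N.
  by rewrite ltnS leq_div2r // ltnW.
pose g (y : 'I_N) : 'I_(N %/ n).+1 := Ordinal (ltq y).
pose D := [set y : r.-tuple 'I_N | map_tuple f y \in C].
have covD : covering_insertion_code k D.
  apply/forallP => a.
  have /existsP [x /andP [xC /subseqP [m _ /= x_eq]]] :=
    forallP covC (map_tuple f a).
  have map_b : map f (mask m a) = x by rewrite x_eq map_mask.
  have size_b : size (mask m a) == r by rewrite -(size_map f) map_b size_tuple.
  apply/existsP; exists (Tuple size_b); rewrite inE /covers mask_subseq andbT.
  by rewrite (_ : map_tuple f _ = x) //; apply: val_inj.
apply: leq_trans (insertion_number_le lerk covD) _.
have fg_inj : injective (fun y => (f y, g y)).
  move=> y z [eqm eqd]; apply: val_inj.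
  by rewrite /= (divn_eq y n) (divn_eq z n) eqm eqd.
have tup_inj : injective (fun y : r.-tuple 'I_N => (map_tuple f y, map_tuple g y)).
  move=> y z [eqf eqg]; apply/val_inj/(inj_map fg_inj).
  by rewrite -!(zip_map f g) eqf eqg.
rewrite -(card_imset _ tup_inj).
have -> : ((N %/ n).+1 ^ r)%N = #|[set: r.-tuple 'I_(N %/ n).+1]|.
  by rewrite cardsT card_tuple card_ord.
rewrite -cardsX subset_leq_card //; apply/fintype.subsetP => _ /imsetP [y yD ->].
by rewrite !inE /= andbT; rewrite inE in yD.
Qed.

(** * Existence and comparison of the limits *)

Local Open Scope classical_set_scope.

Lemma cvg_expr1Ddivn (R : realType) (c : R) (r : nat) :
  (1 + c / n%:R) ^+ r @[n --> \oo] --> (1 : R).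
Proof.
rewrite -[X in _ --> X](expr1n R r).
apply: (@continuous_cvg _ _ _ _ _ (fun n : nat => 1 + c / n%:R)
  (fun x : R => x ^+ r)).
  exact: exprn_continuous.
rewrite -[X in _ --> X]addr0 -(mulr0 c).
apply: cvgD; first exact: cvg_cst.
apply: cvgMl_tmp; rewrite -cvg_shiftS; exact: cvg_harmonic.
Qed.

(** The limit is the infimum of the values [u n] with [n > 0]: letting [N] tend
to infinity in the hypothesis bounds the upper limit of [u] by each [u n]. *)
Lemma is_cvg_of_dilation (R : realType) (u : nat -> R) (r : nat) :
  (forall n, 0 <= u n) ->
  (forall n N, (0 < n)%N -> (0 < N)%N ->
     u N <= u n * (1 + n%:R / N%:R) ^+ r) ->
  cvgn u.
Proof.
move=> u_ge0 u_le; pose E : set R := [set u n | n in [set n : nat | (0 < n)%N]].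
have lbE : has_lbound E by exists 0 => _ [n _ <-].
have infE : has_inf E by split=> //; exists (u 1%N); exists 1%N.
apply/cvg_ex; exists (inf E); apply/cvgrPdist_lt => e e_gt0.
have [_ [n n_gt0 <-] un_lt] := inf_adherent e_gt0 infE.
have un_cvg : u n * (1 + n%:R / N%:R) ^+ r @[N --> \oo] --> u n.
  rewrite -[X in _ --> X]mulr1; apply: cvgMl_tmp; exact: cvg_expr1Ddivn.
near=> N.
have N_gt0 : (0 < N)%N by near: N; exact: nbhs_infty_gt.
have inf_le : inf E <= u N by apply: ge_inf => //; exists N.
rewrite distrC ger0_norm ?subr_ge0 // ltrBlDl.
apply: le_lt_trans (u_le n N n_gt0 N_gt0) _.
near: N; exact: (cvgr_lt (u n) un_cvg _ un_lt).
Unshelve. all: by end_near.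
Qed.

Lemma is_cvg_insertion_ratio (R : realType) (k r : nat) :
  (r <= k)%N ->
  cvgn (fun n : nat => (insertion_number n k r)%:R / n%:R ^+ r : R).
Proof.
move=> lerk; apply: (@is_cvg_of_dilation _ _ r) => [n|n N n_gt0 N_gt0].
  by rewrite divr_ge0 ?exprn_ge0.
have n_neq0 : n%:R != 0 :> R by rewrite pnatr_eq0 -lt0n.
have N_neq0 : N%:R != 0 :> R by rewrite pnatr_eq0 -lt0n.
have -> : 1 + n%:R / N%:R = (n + N)%:R / N%:R :> R.
  by rewrite natrD mulrDl divff // addrC.
rewrite expr_div_n mulrA ler_pM2r ?invr_gt0 ?exprn_gt0 ?ltr0n //.
rewrite mulrAC -mulrA -expr_div_n.
apply: (@le_trans _ _ ((insertion_number n k r)%:R * (N %/ n).+1%:R ^+ r)).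
  by rewrite -natrX -natrM ler_nat; exact: insertion_number_blowup.
apply: ler_wpM2l => //; rewrite lerXn2r ?nnegrE ?divr_ge0 //.
rewrite ler_pdivlMr ?ltr0n // -natrM ler_nat mulSn leq_add2l.
exact: leq_trunc_div.
Qed.

Lemma is_cvg_turan_ratio (R : realType) (k r : nat) :
  (r <= k)%N ->
  cvgn (fun n : nat => (turan_number n k r)%:R / 'C(n, r)%:R : R).
Proof.
move=> lerk; apply: nondecreasing_is_cvgn.
  apply/nondecreasing_seqP => n.
  have [lern|ltnr] := leqP r n; last first.
    by rewrite bin_small // invr0 mulr0 divr_ge0.
  have bn_gt0 : (0 < 'C(n, r))%N by rewrite bin_gt0.
  have bS_gt0 : (0 < 'C(n.+1, r))%N by rewrite bin_gt0 ltnW.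
  rewrite ler_pdivrMr ?ltr0n // mulrAC ler_pdivlMr ?ltr0n // -!natrM ler_nat.
  (* Clear C(n + 1, r) through (n + 1 - r) C(n + 1, r) = (n + 1) C(n, r). *)
  have d_gt0 : (0 < n.+1 - r)%N by rewrite subn_gt0.
  rewrite -(leq_pmul2r d_gt0) -mulnA [('C(n.+1, r) * _)%N]mulnC -mul_bin_down /=.
  rewrite mulnA (mulnC (turan_number n k r)) [X in (_ <= X)%N]mulnAC.
  rewrite leq_pmul2r //.
  exact: turan_number_succ.
exists 1 => _ [n _ <-].
have [lern|ltnr] := leqP r n; last by rewrite bin_small // invr0 mulr0.
rewrite ler_pdivrMr ?ltr0n ?bin_gt0 // mul1r ler_nat.
exact: turan_number_le_bin.
Qed.

Lemma leq_expn_sub_ffact (n m r : nat) : (r <= m.+1)%N -> ((n - m) ^ r <= n ^_ r)%N.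
Proof.
elim: r => [//|r IHr] lerm; rewrite expnSr ffactnSr leq_mul ?IHr ?leq_sub2l //.
exact: ltnW.
Qed.

(** Since C(n, r) r! = n (n - 1) ... (n - r + 1) >= (n - r)^r, the bound
T(n, k, r) r! <= S(n, k, r) gives
T(n, k, r)/C(n, r) * (1 - r/n)^r <= S(n, k, r)/n^r. *)
Lemma turan_density_le_insertion_density (R : realType) (k r : nat) :
  (r <= k)%N -> turan_density R k r <= insertion_density R k r.
Proof.
move=> lerk.
have turan_cvg : (turan_number n k r)%:R / 'C(n, r)%:R *
    (1 + - r%:R / n%:R) ^+ r @[n --> \oo] --> turan_density R k r.
  rewrite -[X in _ --> X]mulr1.
  by apply: cvgM; [exact: is_cvg_turan_ratio | exact: cvg_expr1Ddivn].
apply: (ler_cvg_to turan_cvg (is_cvg_insertion_ratio (R := R) lerk)).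
near=> n.
have lern : (r < n)%N by near: n; exact: nbhs_infty_gt.
have n_gt0 : (0 < n)%N by apply: leq_trans lern.
have n_neq0 : n%:R != 0 :> R by rewrite pnatr_eq0 -lt0n.
have -> : 1 + - r%:R / n%:R = (n - r)%:R / n%:R :> R.
  by rewrite natrB 1?ltnW // mulrBl divff // mulNr.
rewrite expr_div_n mulrA ler_pM2r ?invr_gt0 ?exprn_gt0 ?ltr0n //.
rewrite mulrAC ler_pdivrMr ?ltr0n ?bin_gt0 1?ltnW // -natrX -!natrM ler_nat.
apply: (@leq_trans (turan_number n k r * n ^_ r)).
  by rewrite leq_mul2l leq_expn_sub_ffact ?orbT.
rewrite -bin_ffact mulnA mulnAC leq_mul2r turan_number_insertion_number //.
by rewrite orbT.
Unshelve. all: by end_near.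
Qed.

Local Close Scope classical_set_scope.

Theorem theorem14 (R : realType) (r : nat) (hr : (3 <= r)%N) :
  let s : R := insertion_density R r.+1 r in
  turan_density R r.+1 r <=
    s + 2 * (r`!)%:R * Num.sqrt (r%:R * r.+1%:R * (1 - s) * (s - r%:R^-1)).
Proof.
lazy zeta; apply: ler_wpDr; last exact: turan_density_le_insertion_density.
by rewrite !mulr_ge0 ?sqrtr_ge0.
Qed.
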